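(* Let $n\ge 1$ be an integer and let $\mathbb{H}_q=\mathbb{H}^n\times\mathbb{R}^3$ be the quaternionic Heisenberg group of dimension $4n+3$. Let $|\cdot|_1$ and $|\cdot|_2$ be any two continuous homogeneous quasi-norms on $\mathbb{H}_q$ that are dilation invariant, i.e. $|\delta_\rho\nu|_i=\rho|\nu|_i$ for all $\rho>0$, $\nu\in\mathbb{H}_q$, $i=1,2$. Then $|\cdot|_1$ and $|\cdot|_2$ are equivalent: there exist constants $C_1,C_2>0$ such that $$C_1|\nu|_1\le|\nu|_2\le C_2|\nu|_1\qquad\text{for all }\nu\in\mathbb{H}_q.$$
   Context: Let $\mathbb{H}\cong\mathbb{R}^4$ denote the quaternions. The quaternionic Heisenberg group $\mathbb{H}_q$ is the set $\mathbb{H}^n\times\mathbb{R}^3\cong\mathbb{R}^{4n}\times\mathbb{R}^3$ with its usual topology and group law $$(u,v)(r,s)=\bigl(u+r,\;v+s+2\,\Im(r\cdot\bar u)\bigr),\qquad r\cdot\bar u=\sum_{j=1}^n r_j\overline{u_j},$$ where $\Im$ is the imaginary part of a quaternion, and imaginary quaternions are identified with $\mathbb{R}^3$. The identity is $0=(0,0)$ and $(u,t)^{-1}=(-u,-t)$. The dilations are $\delta_\rho(u,t)=(\sqrt{\rho}\,u,\rho t)$ for $\rho>0$. A (homogeneous) quasi-norm on $\mathbb{H}_q$ is a function $|\cdot|:\mathbb{H}_q\to[0,\infty)$ such that, for all $\nu,\nu_1,\nu_2\in\mathbb{H}_q$: (i) $|\delta_\rho\nu|=\rho^Q|\nu|$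 for all $\rho>0$, where $Q$ is the degree of homogeneity; (ii) $|\nu|\ge 0$, and $|\nu|=0$ if and only if $\nu=0$; (iii) $|\nu^{-1}|=|\nu|$; (iv) $|\nu_1\nu_2|\le K(|\nu_1|+|\nu_2|)$ for some constant $K\ge 1$ (depending only on the quasi-norm). A quasi-norm is called dilation invariant if $|\delta_\rho\nu|=\rho|\nu|$ for all $\rho>0$ and $\nu\in\mathbb{H}_q$ (that is, $Q=1$ in (i)). *)

(* Defs.v *)
From HB Require Import structures.
From mathcomp Require Import all_boot all_order all_algebra.
From mathcomp Require Import all_classical all_reals all_analysis.
From mathcomp Require Import ring.

Set Implicit Arguments.
Unset Strict Implicit.
Unset Printing Implicit Defensive.

Import Order.TTheory GRing.Theory Num.Theory.
Import numFieldNormedType.Exports.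

Local Open Scope ring_scope.

Section Quaternions.
Variable R : realType.

(* A row (q_0, q_1, q_2, q_3) stands for q_0 + q_1 i + q_2 j + q_3 k. *)
Local Notation quaternion := 'rV[R]_4.
Implicit Types p q : quaternion.

Definition quat (a b c d : R) : quaternion := \row_k [:: a; b; c; d]`_k.

(* The column indices 0, 1, 2, 3 are ring literals of 'I_4. *)
Definition qmul p q : quaternion :=
  quat
    (p 0 0 * q 0 0 - p 0 1 * q 0 1 - p 0 2 * q 0 2 - p 0 3 * q 0 3)
    (p 0 0 * q 0 1 + p 0 1 * q 0 0 + p 0 2 * q 0 3 - p 0 3 * q 0 2)
    (p 0 0 * q 0 2 - p 0 1 * q 0 3 + p 0 2 * q 0 0 + p 0 3 * q 0 1)
    (p 0 0 * q 0 3 + p 0 1 * q 0 2 - p 0 2 * q 0 1 + p 0 3 * q 0 0).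

Definition qconj q : quaternion :=
  quat (q 0 0) (- q 0 1) (- q 0 2) (- q 0 3).

Definition qIm q : 'rV[R]_3 := \row_(k < 3) q 0 (lift ord0 k).

Definition qdot (n : nat) (r u : 'M[R]_(n, 4)) : quaternion :=
  \sum_(j < n) qmul (row j r) (qconj (row j u)).

Definition imdot (n : nat) (r u : 'M[R]_(n, 4)) : 'rV[R]_3 := qIm (qdot r u).

Lemma imdotE n (r u : 'M[R]_(n, 4)) k :
  imdot r u 0 k = \sum_(j < n)
    [:: r j 1 * u j 0 - r j 0 * u j 1 + r j 3 * u j 2 - r j 2 * u j 3;
        r j 2 * u j 0 - r j 0 * u j 2 + r j 1 * u j 3 - r j 3 * u j 1;
        r j 3 * u j 0 - r j 0 * u j 3 + r j 2 * u j 1 - r j 1 * u j 2]`_k.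
Proof.
rewrite !mxE summxE; apply: eq_bigr => j _; rewrite !mxE.
by case: k => [[|[|[|//]]] lk] /=; ring.
Qed.

Lemma imdotDl n (r s u : 'M[R]_(n, 4)) :
  imdot (r + s) u = imdot r u + imdot s u.
Proof.
apply/rowP => k; rewrite !imdotE mxE !imdotE -big_split /=.
apply: eq_bigr => j _; rewrite !mxE.
by case: k => [[|[|[|//]]] lk] /=; ring.
Qed.

Lemma imdotC n (r u : 'M[R]_(n, 4)) : imdot u r = - imdot r u.
Proof.
apply/rowP => k; rewrite !imdotE mxE !imdotE -sumrN.
by apply: eq_bigr => j _; case: k => [[|[|[|//]]] lk] /=; ring.
Qed.

Lemma imdotDr n (r u v : 'M[R]_(n, 4)) :
  imdot r (u + v) = imdot r u + imdot r v.
Proof. by rewrite imdotC imdotDl opprD -!imdotC. Qed.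

Lemma imdot0 n (r : 'M[R]_(n, 4)) : imdot r 0 = 0.
Proof. by apply: (addrI (imdot r 0)); rewrite -imdotDr !addr0. Qed.

Lemma imdotN n (r u : 'M[R]_(n, 4)) : imdot r (- u) = - imdot r u.
Proof. by apply: (addrI (imdot r u)); rewrite -imdotDr !subrr imdot0. Qed.

Lemma imdotxx n (u : 'M[R]_(n, 4)) : imdot u u = 0.
Proof.
apply/rowP => k; rewrite imdotE mxE big1 // => j _.
by case: k => [[|[|[|//]]] lk] /=; ring.
Qed.

End Quaternions.

Section HeisenbergGroup.
Variables (R : realType) (n : nat).

(* Row j of the first component is the j-th quaternion coordinate.  The alias
   keeps the product topology of the pair but not its additive structure. *)
Definition heisenberg : Type := 'M[R]_(n, 4) * 'rV[R]_3.

HB.instance Definition _ :=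
  Topological.copy heisenberg ('M[R]_(n, 4) * 'rV[R]_3)%type.

Definition heis_one : heisenberg := (0, 0).

Definition heis_inv (x : heisenberg) : heisenberg := (- x.1, - x.2).

Definition heis_mul (x y : heisenberg) : heisenberg :=
  (x.1 + y.1, x.2 + y.2 + 2 *: qIm (qdot y.1 x.1)).

Let heis_mulA : associative heis_mul.
Proof.
move=> [u v] [r s] [t w]; rewrite /heis_mul /= -!/(imdot _ _).
rewrite imdotDl imdotDr !scalerDr; congr pair; first by rewrite addrA.
by apply/rowP => k; rewrite !mxE; ring.
Qed.

Let heis_mul1 : left_id heis_one heis_mul.
Proof.
move=> [u v]; rewrite /heis_mul /= -/(imdot _ _).
by rewrite imdot0 scaler0 !add0r addr0.
Qed.

Let heis_1mul : right_id heis_one heis_mul.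
Proof.
move=> [u v]; rewrite /heis_mul /= -/(imdot _ _).
by rewrite imdotC imdot0 oppr0 scaler0 !addr0.
Qed.

Let heis_mulV : left_inverse heis_one heis_inv heis_mul.
Proof.
move=> [u v]; rewrite /heis_mul /= -/(imdot _ _).
by rewrite imdotN imdotxx oppr0 scaler0 addr0 !addNr.
Qed.

Let heis_Vmul : right_inverse heis_one heis_inv heis_mul.
Proof.
move=> [u v]; rewrite /heis_mul /= -/(imdot _ _).
by rewrite imdotC imdotN imdotxx !oppr0 scaler0 addr0 !subrr.
Qed.

HB.instance Definition _ := isGroup.Build heisenberg
  heis_mulA heis_mul1 heis_1mul heis_mulV heis_Vmul.

Definition dilation (rho : R) (x : heisenberg) : heisenberg :=
  (Num.sqrt rho *: x.1, rho *: x.2).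

Record quasi_norm (N : heisenberg -> R) : Prop := QuasiNorm {
  qn_homogeneous : exists Q : R, forall (rho : R) (x : heisenberg),
    0 < rho -> N (dilation rho x) = rho `^ Q * N x;
  qn_ge0 : forall x, 0 <= N x;
  qn_eq0 : forall x, N x = 0 <-> x = 1%g;
  qn_inv : forall x, N (x^-1)%g = N x;
  qn_mul : exists2 K : R, 1 <= K &
    forall x y, N (x * y)%g <= K * (N x + N y) }.

Definition dilation_invariant (N : heisenberg -> R) : Prop :=
  forall (rho : R) (x : heisenberg), 0 < rho -> N (dilation rho x) = rho * N x.

End HeisenbergGroup.

(* Main.v *)
Require Import Defs.
From mathcomp Require Import all_boot all_order all_algebra.
From mathcomp Require Import all_classical all_reals all_analysis.

(** Homogeneity reduces the comparison of two quasi-norms to a compact set.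
    The gauge [max (|u|^2) |v|] scales like a dilation invariant quasi-norm
    and vanishes only at the identity, so every other point is a dilate of a
    point of its unit sphere ([heisenberg_polar]).  That sphere is closed and
    bounded, hence compact ([compact_gauge_sphere]).  The identity is not on
    it, so there the quotient of one quasi-norm by the other is continuous,
    hence bounded by some constant.  Both quasi-norms being homogeneous of the
    same degree, the quotient is constant on the orbits of the dilations and
    the bound holds everywhere ([quasi_norm_dominated]).  Exchanging the two
    quasi-norms gives the other inequality. *)

Import Order.TTheory GRing.Theory Num.Theory.
Import numFieldNormedType.Exports.

Local Open Scope ring_scope.
Local Open Scope classical_set_scope.

Lemma vec_mx_continuous (R : realType) (m p : nat) :
  continuous (vec_mx : 'rV[R]_(m * p) -> 'M[R]_(m, p)).
Proof.
move=> v A /nbhs_ballP [e e0 eA].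
apply/nbhs_ballP; exists e => //= w [_ vw]; apply: eA; split=> // i j.
by rewrite !mxE; exact: vw.
Qed.

Lemma closed_norm_le1 (R : realType) (V : normedModType R) :
  closed [set v : V | `|v| <= 1].
Proof.
rewrite (_ : mkset _ = Num.norm @^-1` [set t : R | t <= 1]) //.
by apply: closed_comp => [v _|]; [exact: norm_continuous|exact: closed_le].
Qed.

(** Flattening a matrix into a row turns this into the Heine-Borel theorem for
    rows. *)
Lemma compact_mx_unit_ball (R : realType) (m p : nat) :
  compact [set M : 'M[R]_(m, p) | `|M| <= 1].
Proof.
have row_ball : compact [set v : 'rV[R]_(m * p) | `|v| <= 1].
  apply: bounded_closed_compact.
    by exists 1; split=> // M M1 v /= /le_trans; apply; exact: ltW.
  exact: closed_norm_le1.
apply: (@subclosed_compact _ _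
  (vec_mx @` [set v : 'rV[R]_(m * p) | `|v| <= 1])).
- exact: closed_norm_le1.
- apply: continuous_compact row_ball; apply: continuous_subspaceT.
  exact: vec_mx_continuous.
- move=> M /= M1; exists (mxvec M); last exact: mxvecK.
  apply: le_trans M1; rewrite /Num.norm /= !mx_normrE.
  apply/bigmax_leP; split=> [|[i k] _ /=].
    by apply: bigmax_ge_id.
  rewrite ord1; case/mxvec_indexP: k => a b; rewrite mxvecE.
  exact: (le_bigmax _ (fun ij => `|M ij.1 ij.2|) (a, b)).
Qed.

Section Gauge.
Context {R : realType} {n : nat}.
Implicit Types x : heisenberg R n.

(** The square compensates for the square root in the dilations. *)
Definition gauge x : R := Num.max (`|x.1| ^+ 2) `|x.2|.

Lemma gauge_ge0 x : 0 <= gauge x.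
Proof. by rewrite /gauge le_max sqr_ge0. Qed.

Lemma gauge_dilation (rho : R) x : 0 < rho ->
  gauge (dilation rho x) = rho * gauge x.
Proof.
move=> rho0; rewrite /gauge /= !normrZ exprMn ger0_norm ?sqrtr_ge0//.
by rewrite sqr_sqrtr ?(ltW rho0)// (gtr0_norm rho0) maxr_pMr// ltW.
Qed.

Lemma gauge_eq0 x : gauge x = 0 -> x = 1%g.
Proof.
move=> g0; have le_g t : t <= gauge x -> 0 <= t -> t = 0.
  by rewrite g0 => t0 t1; apply/eqP; rewrite eq_le t0 t1.
have /eqP : `|x.1| ^+ 2 = 0.
  by apply: le_g; rewrite ?sqr_ge0// /gauge le_max lexx.
rewrite expf_eq0 /= normr_eq0 => /eqP u0.
have /eqP : `|x.2| = 0 by apply: le_g => //; rewrite /gauge le_max lexx orbT.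
by rewrite normr_eq0 => /eqP v0; case: x u0 v0 {g0 le_g} => u v /= -> ->.
Qed.

Lemma gauge1 : gauge 1%g = 0.
Proof. by rewrite /gauge /= !normr0 expr0n maxxx. Qed.

Lemma gauge_continuous : continuous gauge.
Proof.
move=> x.
have norm1_cont : {for x, continuous (fun y : heisenberg R n => `|y.1|)}.
  by apply: cvg_norm; exact: cvg_fst.
have norm2_cont : {for x, continuous (fun y : heisenberg R n => `|y.2|)}.
  by apply: cvg_norm; exact: cvg_snd.
apply: (@continuous_max _ _ (fun y => `|y.1| ^+ 2)) => //.
exact: continuous_comp norm1_cont (@exprn_continuous _ 2 _).
Qed.

Lemma compact_gauge_sphere : compact [set x | gauge x = 1].
Proof.
apply: (@subclosed_compact _ _
  ([set M : 'M[R]_(n, 4) | `|M| <= 1] `*` [set v : 'rV[R]_3 | `|v| <= 1])).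
- rewrite (_ : mkset _ = gauge @^-1` [set t : R | t = 1]) //.
  by apply: closed_comp => [x _|]; [exact: gauge_continuous|exact: closed_eq].
- by apply: compact_setX; exact: compact_mx_unit_ball.
- move=> x /= gx1; have: gauge x <= 1 by rewrite gx1.
  by rewrite /gauge ge_max expr_le1 // => /andP[].
Qed.

(** Polar coordinates: dilating by the inverse of the gauge lands on the
    sphere. *)
Lemma heisenberg_polar x : x <> 1%g ->
  exists rho : R, 0 < rho /\ gauge (dilation rho x) = 1.
Proof.
move=> x1; have g0 : 0 < gauge x.
  by rewrite lt_neqAle gauge_ge0 andbT; apply/eqP => /esym /gauge_eq0.
exists (gauge x)^-1; split; first by rewrite invr_gt0.
by rewrite gauge_dilation ?invr_gt0// mulVf// gt_eqF.
Qed.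

(** The quotient [N' / N] is continuous on the compact gauge sphere, hence
    bounded there by a constant, which is then valid on every dilation orbit
    because both sides of the inequality scale by the same factor. *)
Lemma quasi_norm_dominated (N N' : heisenberg R n -> R) :
  continuous N -> continuous N' ->
  quasi_norm N -> quasi_norm N' ->
  dilation_invariant N -> dilation_invariant N' ->
  exists C : R, 0 < C /\ forall x, N' x <= C * N x.
Proof.
move=> cN cN' qN qN' dN dN'.
have N_gt0 x : x <> 1%g -> 0 < N x.
  move=> x1; rewrite lt_neqAle (qn_ge0 qN) andbT.
  by apply/eqP => /esym /(qn_eq0 qN).
have sphere_neq1 x : gauge x = 1 -> x <> 1%g.
  by move=> gx xE; move: gx; rewrite xE gauge1 => /esym/eqP; rewrite oner_eq0.
have : compact ((fun x => N' x / N x) @` [set x | gauge x = 1]).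
  apply: continuous_compact compact_gauge_sphere.
  apply: continuous_in_subspaceT => x /[!inE] gx.
  apply: (@continuousM R _ N' (fun y => (N y)^-1)); first exact: cN'.
  by apply: continuousV; [rewrite gt_eqF// N_gt0//; exact: sphere_neq1|exact: cN].
move=> /compact_bounded [M [_ bM]].
(* The bound must exceed [M] and be positive, whatever the sign of [M]. *)
have bnd x : gauge x = 1 -> N' x <= (`|M| + 1) * N x.
  move=> gx; rewrite -ler_pdivrMr; last by apply: N_gt0; exact: sphere_neq1.
  apply: le_trans (ler_norm _) _; apply: bM; last by exists x.
  by rewrite (le_lt_trans (ler_norm M))// ltrDl.
exists (`|M| + 1); split; first by rewrite ltr_wpDl.
move=> x; have [->|x1] := pselect (x = 1%g).
  by rewrite (qn_eq0 qN' _).2// (qn_eq0 qN _).2// mulr0.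
have [rho [rho0 /bnd]] := heisenberg_polar _ x1.
by rewrite dN// dN'// mulrCA ler_pM2l.
Qed.

End Gauge.

Theorem theorem2p4 (R : realType) (n : nat) (N1 N2 : heisenberg R n -> R)
    (n_ge1 : (1 <= n)%N)
    (N1_cont : continuous N1) (N2_cont : continuous N2)
    (N1_qn : quasi_norm N1) (N2_qn : quasi_norm N2)
    (N1_dil : dilation_invariant N1) (N2_dil : dilation_invariant N2) :
  exists C1 C2 : R, 0 < C1 /\ 0 < C2 /\
    forall x : heisenberg R n, C1 * N1 x <= N2 x /\ N2 x <= C2 * N1 x.
Proof.
have [C [C0 leC]] :=
  quasi_norm_dominated _ _ N2_cont N1_cont N2_qn N1_qn N2_dil N1_dil.
have [D [D0 leD]] :=
  quasi_norm_dominated _ _ N1_cont N2_cont N1_qn N2_qn N1_dil N2_dil.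
exists C^-1, D; rewrite invr_gt0; split=> //; split=> // x; split=> //.
by rewrite ler_pdivrMl.
Qed.
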